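(* Let $K\ge2$, let $\mathbf{p}$ be a probability vector on $[K]$ with all $p_k>0$, and let $\mathbf{W},\mathbf{W}'$ be $K\times K$ invertible row-stochastic matrices. Fix a projection map $\mathrm{Proj}_{\mathbb{P}}$ as in the context, and let $\mathscr{L}^{(n)}$ denote any one of the three loss metrics defined in the context. Assume that (1) in the case of the $f$-divergence loss, $f$ is strictly convex at $x=1$; (2) $\mathbf{W}'$ is not a permutation matrix. Then for all sufficiently large $n$, $$\mathscr{L}^{(n)}(\mathbf{p},\mathbf{W}\mathbf{W}')>\mathscr{L}^{(n)}(\mathbf{p},\mathbf{W}).$$
   Context: For a $K\times K$ invertible row-stochastic channel $\mathbf{V}$: $X_1,\dots,X_n$ are i.i.d. with law $\mathbf{p}$, each passed independently through $\mathbf{V}$ ($\Pr\{Y_i=\ell\mid X_i=k\}=V_{k,\ell}$), giving $\mathbf{y}_n$ with empirical distribution $\mathbf{t}(\mathbf{y}_n)$; the estimator is $\hat{\mathbf{p}}_n=\mathrm{Proj}_{\mathbb{P}}(\mathbf{t}(\mathbf{y}_n)\mathbf{V}^{-1})$, where $\mathbb{P}$ is the probability simplex and $\mathrm{Proj}_{\mathbb{P}}$ maps vectors with entries summing to one into $\mathbb{P}$ with $\mathrm{Proj}_{\mathbb{P}}(\mathbf{v})=\mathbf{v}$ for $\mathbf{v}\in\mathbb{P}$. The losses are $\mathscr{L}^{(n)}_{f\text{-DIV}}(\mathbf{p},\mathbf{V})=\mathbb{E}[\sum_k p_kf(\hat p_{n,k}/p_k)]$ for a convex $f$ with $f(1)=0$;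 $\mathscr{L}^{(n)}_{\rm MSE}(\mathbf{p},\mathbf{V})=\mathbb{E}\Vert\hat{\mathbf{p}}_n-\mathbf{p}\Vert_2^2$; $\mathscr{L}^{(n)}_{\rm TV}(\mathbf{p},\mathbf{V})=\mathbb{E}\Vert\hat{\mathbf{p}}_n-\mathbf{p}\Vert_1$. The theorem compares $\mathbf{V}=\mathbf{W}$ with $\mathbf{V}=\mathbf{W}\mathbf{W}'$ (the latter equivalent to passing the outputs of $\mathbf{W}$ through $\mathbf{W}'$). ''$f$ strictly convex at $1$'' means $f(\lambda(1-\epsilon)+(1-\lambda)(1+\epsilon'))<\lambda f(1-\epsilon)+(1-\lambda)f(1+\epsilon')$ for all $\epsilon,\epsilon'>0$ and $\lambda\in(0,1)$. *)

(* Defs.v *)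
From HB Require Import structures.
From mathcomp Require Import all_boot all_order all_algebra all_fingroup.
From mathcomp Require Import reals.

Set Implicit Arguments.
Unset Strict Implicit.
Unset Printing Implicit Defensive.

Import Order.TTheory GRing.Theory Num.Theory.
Local Open Scope ring_scope.

Section Defs.
Variable R : realType.
Variable K : nat.

Definition in_simplex (v : 'rV[R]_K) : Prop :=
  (forall k, 0 <= v 0 k) /\ \sum_k v 0 k = 1.

Definition row_stochastic (V : 'M[R]_K) : Prop :=
  (forall k l, 0 <= V k l) /\ (forall k, \sum_l V k l = 1).

Definition simplex_projection (Proj : 'rV[R]_K -> 'rV[R]_K) : Prop :=
  (forall v : 'rV[R]_K, \sum_k v 0 k = 1 -> in_simplex (Proj v)) /\
  (forall v : 'rV[R]_K, in_simplex v -> Proj v = v).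

Definition empirical n (y : {ffun 'I_n -> 'I_K}) : 'rV[R]_K :=
  \row_l ((#|[set i | y i == l]|)%:R / n%:R).

Definition estimator (Proj : 'rV[R]_K -> 'rV[R]_K) (V : 'M[R]_K) n
  (y : {ffun 'I_n -> 'I_K}) : 'rV[R]_K :=
  Proj (empirical y *m invmx V).

(* expectation of g(y_n) where X_i ~ p i.i.d. and Y_i | X_i = k ~ V k . *)
Definition expect (p : 'rV[R]_K) (V : 'M[R]_K) n
  (g : {ffun 'I_n -> 'I_K} -> R) : R :=
  \sum_(xy : {ffun 'I_n -> 'I_K * 'I_K})
     (\prod_i (p 0 (xy i).1 * V (xy i).1 (xy i).2)) *
     g [ffun i => (xy i).2].

Definition loss_fdiv (f : R -> R) Proj (p : 'rV[R]_K) V n : R :=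
  expect p V (fun y : {ffun 'I_n -> 'I_K} =>
    \sum_k p 0 k * f (estimator Proj V y 0 k / p 0 k)).

Definition loss_mse Proj (p : 'rV[R]_K) V n : R :=
  expect p V (fun y : {ffun 'I_n -> 'I_K} =>
    \sum_k (estimator Proj V y 0 k - p 0 k) ^+ 2).

Definition loss_tv Proj (p : 'rV[R]_K) V n : R :=
  expect p V (fun y : {ffun 'I_n -> 'I_K} =>
    \sum_k `|estimator Proj V y 0 k - p 0 k|).

End Defs.

Definition convex_nonneg (R : realType) (f : R -> R) : Prop :=
  forall x y lam, 0 <= x -> 0 <= y -> 0 <= lam <= 1 ->
    f (lam * x + (1 - lam) * y) <= lam * f x + (1 - lam) * f y.

(* f strictly convex at 1 (with 1 - eps kept in the domain [0,+oo)) *)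
Definition strictly_convex_at1 (R : realType) (f : R -> R) : Prop :=
  forall eps eps' lam, 0 < eps <= 1 -> 0 < eps' -> 0 < lam < 1 ->
    f (lam * (1 - eps) + (1 - lam) * (1 + eps'))
      < lam * f (1 - eps) + (1 - lam) * f (1 + eps').

(* Main.v *)
(* Write [q = p W]. Feeding a sample [y] of law [q] into [W'] produces [z] with
   [E[t(z) (W W')^-1 | y] = t(y) W^-1], so before projection the estimates [x] (from [y]) and [u]
   (from [z]) form a martingale and Jensen's inequality applies to every loss that is a sum of
   convex functions of the coordinates. The projection matters only outside an event of
   probability [1 - O(r^n)] with [r < 1], on which both estimates lie in the simplex.
   It remains to bound the Jensen gap from below by [c rho^n] for some [rho > r]. Since [W'] is not
   a permutation, some row charges two letters on which a coordinate of [(W W')^-1] differs. Moving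
   a small mass between them gives two channels under which that coordinate of [u] concentrates
   strictly below, respectively above, [p_k]; they cost only a factor [rho^n] in probability, with
   [rho] as close to 1 as desired, and strict convexity at [p_k] makes these excursions of [u]
   produce a gap of constant size. *)

Require Import Defs.
From HB Require Import structures.
From mathcomp Require Import all_boot all_order all_algebra all_fingroup.
From mathcomp Require Import classical_sets reals ring lra.
Set Implicit Arguments.
Unset Strict Implicit.
Unset Printing Implicit Defensive.

Import Order.TTheory GRing.Theory Num.Theory.
Local Open Scope ring_scope.

(** * Exponentially small sequences *)

Section ExponentiallySmall.
Context {R : realType}.

(** One-sided on purpose: the bound passes to anything pointwise smaller, which suits probabilities
    of bad events. *)
Definition exp_small (a : nat -> R) : Prop :=
  exists C rho, [/\ 0 <= C, 0 < rho < 1 & forall n, a n <= C * rho ^+ n].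

Lemma exp_small_le (a b : nat -> R) :
  (forall n, a n <= b n) -> exp_small b -> exp_small a.
Proof.
by move=> ab [C [rho [C0 r01 bC]]]; exists C, rho; split=> // n; apply: le_trans (ab n) (bC n).
Qed.

Lemma exp_small0 : exp_small (fun=> 0).
Proof. by exists 0, 2^-1; split=> // [|n]; [lra | rewrite mul0r]. Qed.

Lemma exp_smallD (a b : nat -> R) :
  exp_small a -> exp_small b -> exp_small (fun n => a n + b n).
Proof.
move=> [C [r [C0 /andP[r0 r1] aC]]] [D [s [D0 /andP[s0 s1] bD]]].
pose m := Order.max r s.
have rm : r <= m by rewrite le_max lexx.
have sm : s <= m by rewrite le_max lexx orbT.
exists (C + D), m; split; first exact: addr_ge0.
  by rewrite (lt_le_trans r0 rm) gt_max r1.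
move=> n; rewrite mulrDl; apply: lerD.
  apply: le_trans (aC n) _; rewrite ler_wpM2l // lerXn2r // nnegrE ?ltW //.
  exact: lt_le_trans rm.
apply: le_trans (bD n) _; rewrite ler_wpM2l // lerXn2r // nnegrE ?ltW //.
exact: lt_le_trans sm.
Qed.

Lemma exp_smallZ (c : R) (a : nat -> R) :
  0 <= c -> exp_small a -> exp_small (fun n => c * a n).
Proof.
move=> c0 [C [r [C0 r01 aC]]]; exists (c * C), r; split=> // [|n].
  exact: mulr_ge0.
by rewrite -mulrA ler_wpM2l.
Qed.

Lemma exp_small_sum (I : finType) (a : I -> nat -> R) :
  (forall i, exp_small (a i)) -> exp_small (fun n => \sum_i a i n).
Proof.
move=> aS; elim: (index_enum I) => [|i s IHs].
  by apply: exp_small_le exp_small0 => n; rewrite big_nil.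
by apply: exp_small_le (exp_smallD (aS i) IHs) => n; rewrite big_cons.
Qed.

Lemma bernoulli_le (h : R) n : 0 <= h -> 1 + n%:R * h <= (1 + h) ^+ n.
Proof.
move=> h0; elim: n => [|n IHn]; first by rewrite mul0r addr0 expr0.
rewrite exprS -natr1; have n0 : 0 <= n%:R :> R by [].
have : (1 + h) * (1 + n%:R * h) <= (1 + h) * (1 + h) ^+ n.
  by rewrite ler_wpM2l //; lra.
by apply: le_trans; have := mulr_ge0 n0 (mulr_ge0 h0 h0); lra.
Qed.

(** Writing [r^-1 = 1 + h], Bernoulli's inequality makes the inverse powers of [r] grow at least
    linearly, which yields an explicit threshold. *)
Lemma geometric_lt (r C e : R) : 0 < r < 1 -> 0 < e ->
  exists N, forall n, (N <= n)%N -> C * r ^+ n < e.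
Proof.
move=> /andP[r0 r1] e0.
pose h := r^-1 - 1.
have h0 : 0 < h by rewrite subr_gt0 invf_gt1.
exists (Num.bound (`|C| / (e * h))) => n Nn.
have n_gt : `|C| / (e * h) < n%:R.
  apply: lt_le_trans (archi_boundP _) _; last by rewrite ler_nat.
  by apply: divr_ge0 => //; apply: mulr_ge0; exact: ltW.
rewrite ltr_pdivrMr ?mulr_gt0 // in n_gt.
have rn0 : 0 < r ^+ n by rewrite exprn_gt0.
rewrite -ltr_pdivlMr // -exprVn.
have -> : r^-1 = 1 + h by rewrite /h; ring.
have bern := bernoulli_le n (ltW h0).
apply: le_lt_trans (ler_norm C) _; apply: lt_le_trans n_gt _.
apply: (@le_trans _ _ (e * (1 + n%:R * h))).
  by rewrite [leRHS]mulrDr mulr1 [X in _ <= _ + X]mulrCA lerDr ltW.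
by rewrite ler_wpM2l // ltW.
Qed.

Lemma exp_small_eventually (a : nat -> R) (e : R) :
  exp_small a -> 0 < e -> exists N, forall n, (N <= n)%N -> a n < e.
Proof.
move=> [C [r [C0 r01 aC]]] e0; have [N CN] := geometric_lt C r01 e0.
by exists N => n /CN; apply: le_lt_trans.
Qed.

End ExponentiallySmall.

(** * Product expectations *)

Section ProductExpectation.
Context {R : realType}.

Definition iid_expect {T : finType} (mu : T -> R) n (g : {ffun 'I_n -> T} -> R) : R :=
  \sum_(w : {ffun 'I_n -> T}) (\prod_i mu (w i)) * g w.

Section Linear.
Context {T : finType} (mu : T -> R).

Lemma iid_expectD n (g h : {ffun 'I_n -> T} -> R) :
  iid_expect mu (fun w => g w + h w) = iid_expect mu g + iid_expect mu h.
Proof. by rewrite -big_split; apply: eq_bigr => w _; rewrite mulrDr. Qed.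

Lemma iid_expectZ n c (g : {ffun 'I_n -> T} -> R) :
  iid_expect mu (fun w => c * g w) = c * iid_expect mu g.
Proof. by rewrite big_distrr; apply: eq_bigr => w _; rewrite /= mulrCA. Qed.

Lemma iid_expectB n (g h : {ffun 'I_n -> T} -> R) :
  iid_expect mu (fun w => g w - h w) = iid_expect mu g - iid_expect mu h.
Proof.
rewrite -mulN1r -iid_expectZ -iid_expectD.
by apply: eq_bigr => w _; rewrite mulN1r.
Qed.

Lemma iid_expect_sum n (I : finType) (g : I -> {ffun 'I_n -> T} -> R) :
  iid_expect mu (fun w => \sum_i g i w) = \sum_i iid_expect mu (g i).
Proof. by rewrite exchange_big; apply: eq_bigr => w _; rewrite big_distrr. Qed.

Lemma iid_expect_prod n (psi : T -> R) :
  iid_expect mu (fun w : {ffun 'I_n -> T} => \prod_i psi (w i)) =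
  (\sum_t mu t * psi t) ^+ n.
Proof.
rewrite -[n in RHS]card_ord -prodr_const bigA_distr_bigA.
by apply: eq_bigr => w _; rewrite big_split.
Qed.

Lemma iid_expect_const n c : \sum_t mu t = 1 ->
  iid_expect mu (fun _ : {ffun 'I_n -> T} => c) = c.
Proof.
move=> mu1; rewrite /iid_expect -big_distrl /=.
by rewrite -(bigA_distr_bigA (fun _ => mu)) /= big1 ?mul1r.
Qed.

Lemma iid_expect_le n (g h : {ffun 'I_n -> T} -> R) : (forall t, 0 <= mu t) ->
  (forall w, g w <= h w) -> iid_expect mu g <= iid_expect mu h.
Proof.
move=> mu0 gh; apply: ler_sum => w _; rewrite ler_wpM2l //.
exact: prodr_ge0.
Qed.

(** Change of measure: the product weights compare factor by factor. It turns typical behaviour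
    under a tilted law [nu] into a lower bound under [mu], at the price [rho ^+ n]. *)
Lemma iid_expect_dominated (nu : T -> R) rho n (g : {ffun 'I_n -> T} -> R) :
  0 <= rho -> (forall t, 0 <= nu t) -> (forall t, rho * nu t <= mu t) ->
  (forall w, 0 <= g w) -> rho ^+ n * iid_expect nu g <= iid_expect mu g.
Proof.
move=> rho0 nu0 numu g0; rewrite /iid_expect big_distrr /=; apply: ler_sum => w _.
have -> : rho ^+ n = \prod_(i < n) rho by rewrite prodr_const card_ord.
rewrite mulrA ler_wpM2r // -big_split /=.
by apply: ler_prod => i _; rewrite numu mulr_ge0.
Qed.

End Linear.

Section Pushforward.
Context {S T : finType} (mu : T -> R) (h : T -> S).

Definition pushforward (s : S) : R := \sum_(t | h t == s) mu t.

(** The factor [F] may depend on the index, so that one coordinate can carry an extra term. *)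
Lemma iid_expect_fiber n (s : {ffun 'I_n -> S}) (F : 'I_n -> T -> R) :
  \sum_(w : {ffun 'I_n -> T} | [ffun i => h (w i)] == s) \prod_i F i (w i) =
  \prod_i \sum_(t | h t == s i) F i t.
Proof.
rewrite bigA_distr_big_dep /=; apply: eq_bigl => w.
apply/eqP/familyP => [<- i | ws]; first by rewrite ffunE unfold_in.
by apply/ffunP => i; rewrite ffunE; apply/eqP; exact: ws.
Qed.

Lemma iid_expect_map n (g : {ffun 'I_n -> S} -> R) :
  iid_expect mu (fun w : {ffun 'I_n -> T} => g [ffun i => h (w i)]) =
  iid_expect pushforward g.
Proof.
rewrite /iid_expect (partition_big (fun w : {ffun 'I_n -> T} => [ffun i => h (w i)]) xpredT) //=.
apply: eq_bigr => s _; rewrite -(iid_expect_fiber s (fun=> mu)) big_distrl /=.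
by apply: eq_bigr => w /eqP ->.
Qed.

(** [X] has conditional mean zero given [h]: on each fiber of [h] the sum factorizes over the
    coordinates, and the factor at [i0] vanishes. *)
Lemma iid_expect_centered n (g : {ffun 'I_n -> S} -> R) (X : T -> R) i0 :
  (forall s, \sum_(t | h t == s) mu t * X t = 0) ->
  iid_expect mu (fun w : {ffun 'I_n -> T} => g [ffun i => h (w i)] * X (w i0)) = 0.
Proof.
move=> X0.
rewrite /iid_expect (partition_big (fun w : {ffun 'I_n -> T} => [ffun i => h (w i)]) xpredT) //=.
apply: big1 => s _.
pose F i t := mu t * (if i == i0 then X t else 1).
transitivity (g s * \sum_(w : {ffun 'I_n -> T} | [ffun i => h (w i)] == s) \prod_i F i (w i)).
  rewrite big_distrr /=; apply: eq_bigr => w /eqP ->.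
  rewrite big_split /= mulrCA; congr (_ * (_ * _)).
  by rewrite (bigD1 i0) //= eqxx big1 ?mulr1 // => i /negbTE ->.
rewrite iid_expect_fiber (bigD1 i0) //= /F eqxx X0 mul0r mulr0 //.
Qed.

End Pushforward.

Definition sample_mean {T : finType} (X : T -> R) n (w : {ffun 'I_n -> T}) : R :=
  (\sum_i X (w i)) / n%:R.

Lemma sample_meanN {T : finType} (X : T -> R) n (w : {ffun 'I_n -> T}) :
  sample_mean (fun t => - X t) w = - sample_mean X w.
Proof. by rewrite /sample_mean sumrN mulNr. Qed.

Lemma sample_mean_map {S T : finType} (h : T -> S) (X : S -> R) n (w : {ffun 'I_n -> T}) :
  sample_mean X [ffun i => h (w i)] = sample_mean (X \o h) w.
Proof. by congr (_ / _); apply: eq_bigr => i _; rewrite ffunE. Qed.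

Lemma finite_bound {T : finType} (X : T -> R) :
  exists B : R, 0 < B /\ forall t, `|X t| <= B.
Proof.
exists (1 + \sum_t `|X t|); split; first by rewrite ltr_pwDl // sumr_ge0.
by move=> t; rewrite (bigD1 t) //= addrCA lerDl addr_ge0 // sumr_ge0.
Qed.

Lemma sample_mean_bound {T : finType} (X : T -> R) B n (w : {ffun 'I_n -> T}) :
  0 <= B -> (forall t, `|X t| <= B) -> `|sample_mean X w| <= B.
Proof.
move=> B0 XB; rewrite /sample_mean normrM.
case: n w => [|n] w; first by rewrite big_ord0 normr0 mul0r.
rewrite [X in _ * X]ger0_norm ?invr_ge0 // ler_pdivrMr ?ltr0n //.
apply: le_trans (ler_norm_sum _ _ _) _.
apply: le_trans (ler_sum _ (fun i _ => XB (w i))) _.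
by rewrite sumr_const card_ord mulr_natr.
Qed.

End ProductExpectation.

(** * Exponential concentration of sample means *)

Section Concentration.
Context {R : realType} {T : finType} (mu : T -> R).
Hypotheses (mu_ge0 : forall t, 0 <= mu t) (mu_sum : \sum_t mu t = 1).

(* Markov's inequality with [1 / (1 - th * Y)] in the role of [exp (th * Y)]: by AM-GM the
   product of the [1 - th * Y i] is at most 1 as soon as the [Y i] have a nonnegative sum. *)
Lemma upper_deviation (X : T -> R) (m eta : R) : \sum_t mu t * X t = m -> 0 < eta ->
  exp_small (fun n => iid_expect mu
    (fun w : {ffun 'I_n -> T} => (m + eta <= sample_mean X w)%R%:R)).
Proof.
move=> Xm eta0.
pose Y t := X t - m - eta.
have Ym : \sum_t mu t * Y t = - eta.
  rewrite (eq_bigr (fun t => mu t * X t - mu t * (m + eta))); last first.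
    by move=> t _; rewrite /Y; ring.
  by rewrite sumrB Xm -big_distrl /= mu_sum; ring.
have [B0 [B0_gt0 YB0]] := finite_bound Y.
pose B := B0 + eta.
have B_gt0 : 0 < B by rewrite /B; lra.
have YB t : `|Y t| <= B by apply: le_trans (YB0 t) _; rewrite /B; lra.
(* With this [th] the quadratic error [2 * th ^+ 2 * B ^+ 2] is exactly half of the linear gain
   [th * eta]; since [eta <= B], it also keeps [th * Y t] within [1 / 4]. *)
pose th := eta / (4 * B ^+ 2).
have th0 : 0 < th by rewrite divr_gt0 // mulr_gt0 ?exprn_gt0.
have thB2 : th * B ^+ 2 = eta / 4 by rewrite /th; field; rewrite gt_eqF.
have thB : th * B <= 1 / 4.
  have : th * B * B <= 1 / 4 * B by rewrite -mulrA -expr2 thB2 /B; lra.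
  by rewrite ler_pM2r.
have thY t : `|th * Y t| <= 1 / 4.
  rewrite normrM gtr0_norm //; apply: le_trans thB.
  by rewrite ler_wpM2l // ltW.
have thY_gt0 t : 0 < 1 - th * Y t.
  by have := thY t; rewrite ler_norml => /andP[_]; lra.
pose psi t := (1 - th * Y t)^-1.
have psi_le t : psi t <= 1 + th * Y t + 2 * th ^+ 2 * B ^+ 2.
  rewrite /psi -[leLHS]mul1r ler_pdivrMr //.
  have := thY t; rewrite ler_norml; set z := th * Y t => /andP[z1 z2].
  have zB : z ^+ 2 <= th ^+ 2 * B ^+ 2.
    have zB1 : `|z| <= th * B by rewrite normrM gtr0_norm // ler_wpM2l // ltW.
    rewrite -exprMn -real_normK ?num_real //.
    by rewrite lerXn2r // nnegrE // mulr_ge0 // ltW.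
  rewrite -[2 * th ^+ 2 * _]mulrA; set b := th ^+ 2 * B ^+ 2 in zB *.
  have b0 : 0 <= b by apply: le_trans _ zB; exact: sqr_ge0.
  have : 0 <= b * (1 / 2 - z) by rewrite mulr_ge0 //; lra.
  by rewrite expr2 in zB; lra.
have Epsi : \sum_t mu t * psi t <= 1 - th * eta / 2.
  apply: le_trans (ler_sum _ (fun t _ => ler_wpM2l (mu_ge0 t) (psi_le t))) _.
  rewrite (eq_bigr (fun t => mu t * (1 + 2 * th ^+ 2 * B ^+ 2) + th * (mu t * Y t))); last first.
    by move=> t _; ring.
  rewrite big_split /= -big_distrl -big_distrr /= mu_sum Ym.
  have -> : 2 * th ^+ 2 * B ^+ 2 = 2 * th * (th * B ^+ 2) by ring.
  by rewrite thB2; lra.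
have theta : th * eta <= 1 / 4.
  apply: le_trans thB; rewrite ler_wpM2l ?ltW // /B; lra.
have theta0 := mulr_gt0 th0 eta0.
exists 1, (1 - th * eta / 2); split => // [|n]; first by apply/andP; split; lra.
rewrite mul1r.
apply: (@le_trans _ _ (iid_expect mu (fun w : {ffun 'I_n -> T} => \prod_i psi (w i)))).
  apply: iid_expect_le => // w.
  have psi0 : 0 <= \prod_i psi (w i).
    by apply: prodr_ge0 => i _; rewrite invr_ge0 ltW.
  case: (boolP (m + eta <= _)) => // dev.
  case: n w dev psi0 => [|n] w dev psi0; first by rewrite big_ord0.
  rewrite /psi prodfV invf_ge1 ?prodr_gt0 //.
  have := leif_AGM (A := predT) (E := fun i => 1 - th * Y (w i))
    (fun i _ => ltW (thY_gt0 (w i))).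
  move=> [agm _]; apply: le_trans agm _.
  rewrite exprn_ile1 //; first by rewrite divr_ge0 ?sumr_ge0 // => i _; rewrite ltW.
  rewrite cardT size_enum_ord ler_pdivrMr ?ltr0n // mul1r.
  rewrite sumrB sumr_const cardT size_enum_ord -big_distrr /= gerBl mulr_ge0 ?(ltW th0) //.
  rewrite /Y (eq_bigr (fun i => X (w i) - (m + eta))); last by move=> i _; ring.
  rewrite sumrB sumr_const card_ord. rewrite subr_ge0 -mulr_natr.
  by move: dev; rewrite /sample_mean ler_pdivlMr ?ltr0n.
rewrite iid_expect_prod lerXn2r ?nnegrE //; last lra.
by apply: sumr_ge0 => t _; rewrite mulr_ge0 // invr_ge0 ltW.
Qed.

Lemma lower_deviation (X : T -> R) (m eta : R) : \sum_t mu t * X t = m -> 0 < eta ->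
  exp_small (fun n => iid_expect mu
    (fun w : {ffun 'I_n -> T} => (sample_mean X w <= m - eta)%R%:R)).
Proof.
move=> Xm eta0.
have Xm' : \sum_t mu t * - X t = - m.
  by rewrite -Xm -sumrN; apply: eq_bigr => t _; rewrite mulrN.
apply: exp_small_le (upper_deviation Xm' eta0) => n.
apply: iid_expect_le => // w; rewrite sample_meanN.
by rewrite [in leRHS]lerNr opprD opprK.
Qed.

Lemma deviation (X : T -> R) (m eta : R) : \sum_t mu t * X t = m -> 0 < eta ->
  exp_small (fun n => iid_expect mu
    (fun w : {ffun 'I_n -> T} => (eta <= `|sample_mean X w - m|)%R%:R)).
Proof.
move=> Xm eta0.
apply: exp_small_le (exp_smallD (upper_deviation Xm eta0) (lower_deviation Xm eta0)) => n.
rewrite -iid_expectD; apply: iid_expect_le => // w.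
have -> : (eta <= `|sample_mean X w - m|) =
    (m + eta <= sample_mean X w) || (sample_mean X w <= m - eta).
  by rewrite ler_normr opprB; congr (_ || _); apply/idP/idP; lra.
by rewrite -natrD ler_nat; case: (m + eta <= _); case: (_ <= m - eta).
Qed.

End Concentration.

(** * Supporting lines of convex functions on the half-line *)

Section SupportingLine.
Context {R : realType} (phi : R -> R).
Hypothesis cvx : convex_nonneg phi.

Lemma convex_nonneg_chord x y z : 0 <= x -> x < y -> y < z ->
  (z - x) * phi y <= (z - y) * phi x + (y - x) * phi z.
Proof.
move=> x0 xy yz; have zx : 0 < z - x by lra.
pose lam := (z - y) / (z - x).
have lam01 : 0 <= lam <= 1.
  by rewrite /lam divr_ge0 ?ler_pdivrMr //=; lra.
have := cvx x0 (ltW (le_lt_trans x0 (lt_trans xy yz))) lam01.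
have -> : lam * x + (1 - lam) * z = y by rewrite /lam; field; rewrite gt_eqF.
rewrite -(ler_pM2l zx); congr (_ <= _).
by rewrite /lam; field; rewrite gt_eqF.
Qed.

(** Their supremum is the left derivative, a subgradient at every [x > 0] even where [phi] has a
    kink. *)
Definition left_slopes x : set R :=
  [set (phi x - phi z) / (x - z) | z in [set z | 0 <= z < x]]%classic.

Definition slope x := sup (left_slopes x).

(** Height of [phi] above its supporting line at [x], that is, the Bregman divergence for this
    choice of subgradient. *)
Definition excess x z := phi z - phi x - slope x * (z - x).

Lemma left_slopes_le x y : x < y ->
  ubound (left_slopes x) ((phi y - phi x) / (y - x)).
Proof.
move=> xy _ [z /= /andP[z0 zx] <-].
rewrite ler_pdivrMr ?subr_gt0 // mulrAC ler_pdivlMr ?subr_gt0 //.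
by have := convex_nonneg_chord z0 zx xy; lra.
Qed.

Lemma slope_ge x z : 0 <= z -> z < x -> (phi x - phi z) / (x - z) <= slope x.
Proof.
move=> z0 zx; apply: ub_le_sup.
  by exists ((phi (x + 1) - phi x) / (x + 1 - x)); apply: left_slopes_le; lra.
by exists z => //=; rewrite z0.
Qed.

Lemma slope_le x z : 0 < x -> x < z -> slope x <= (phi z - phi x) / (z - x).
Proof.
move=> x0 xz; apply: ge_sup; last exact: left_slopes_le.
by exists ((phi x - phi 0) / (x - 0)); exists 0 => //=; rewrite lexx.
Qed.

Lemma excess_ge0 x z : 0 < x -> 0 <= z -> 0 <= excess x z.
Proof.
move=> x0 z0; rewrite /excess; case: (ltgtP z x) => [zx|xz|->]; last lra.
  by have := slope_ge z0 zx; rewrite ler_pdivrMr ?subr_gt0 //; lra.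
by have := slope_le x0 xz; rewrite ler_pdivlMr ?subr_gt0 //; lra.
Qed.

(** The excess is convex in its second argument and vanishes at [x], so pulling [z] towards [x]
    cannot increase it. Monotonicity on either side of [x] follows. *)
Lemma excess_convex x z lam : 0 < x -> 0 <= z -> 0 <= lam <= 1 ->
  excess x (lam * z + (1 - lam) * x) <= excess x z.
Proof.
move=> x0 z0 lam01; have := cvx z0 (ltW x0) lam01.
have : 0 <= (1 - lam) * excess x z.
  by rewrite mulr_ge0 ?excess_ge0 //; lra.
rewrite /excess; set s := slope x; set f := phi _.
have -> : s * (lam * z + (1 - lam) * x - x) = lam * (s * (z - x)) by ring.
by lra.
Qed.

Lemma excess_antitone_left x a z : 0 < x -> 0 <= z -> z <= a -> a <= x ->
  excess x a <= excess x z.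
Proof.
move=> x0 z0 za; rewrite le_eqVlt => /predU1P[->|ax].
  by rewrite {1}/excess !subrr mulr0 subrr excess_ge0.
have xz : 0 < x - z by lra.
rewrite -[a in excess x a](_ : (x - a) / (x - z) * z + (1 - (x - a) / (x - z)) * x = a).
  by apply: excess_convex; rewrite // divr_ge0 ?ler_pdivrMr //=; lra.
by field; rewrite gt_eqF.
Qed.

Lemma excess_monotone_right x b z : 0 < x -> x <= b -> b <= z ->
  excess x b <= excess x z.
Proof.
move=> x0 xb bz; have z0 : 0 <= z by lra.
move: xb; rewrite le_eqVlt => /predU1P[<-|xb].
  by rewrite {1}/excess !subrr mulr0 subrr excess_ge0.
have zx : 0 < z - x by lra.
rewrite -[b in excess x b](_ : (b - x) / (z - x) * z + (1 - (b - x) / (z - x)) * x = b).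
  by apply: excess_convex; rewrite // divr_ge0 ?ler_pdivrMr //=; lra.
by field; rewrite gt_eqF.
Qed.

Definition half_line_bound := `|phi 0| + `|phi 2| + 2 * `|phi 1|.

Lemma half_line_bound_ge0 : 0 <= half_line_bound.
Proof. by rewrite !addr_ge0 ?mulr_ge0. Qed.

(** The chord from 0 to 2 bounds [phi] from above. Reflecting [z] to [2 - z] and using convexity at
    the midpoint 1 turns this into a lower bound. *)
Lemma phi_bound (z : R) : 0 <= z <= 2 -> `|phi z| <= half_line_bound.
Proof.
have upper (t : R) : 0 <= t <= 2 -> phi t <= `|phi 0| + `|phi 2|.
  move=> /andP[t0 t2].
  have l01 : 0 <= 1 - t / 2 <= 1 by lra.
  have := cvx (lexx 0) (ler0n _ 2) l01.
  have -> : (1 - t / 2) * 0 + (1 - (1 - t / 2)) * 2 = t by field.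
  move=> /le_trans; apply; apply: lerD.
    apply: le_trans (ler_norm _) _; rewrite normrM ler_piMl // ger0_norm; lra.
  apply: le_trans (ler_norm _) _; rewrite normrM ler_piMl // ger0_norm; lra.
move=> /andP[z0 z2].
have zU : phi z <= `|phi 0| + `|phi 2| by apply: upper; lra.
have zU' : phi (2 - z) <= `|phi 0| + `|phi 2| by apply: upper; lra.
have h : 0 <= (2^-1 : R) <= 1 by lra.
have z2' : 0 <= 2 - z by lra.
have := cvx z0 z2' h.
have -> : 2^-1 * z + (1 - 2^-1) * (2 - z) = 1 by field.
rewrite /half_line_bound ler_norml => mid; have := normr_ge0 (phi 1).
have /ler_normlP[n1 n2] := lexx `|phi 1|.
by move=> n0; apply/andP; split; lra.
Qed.

Definition slope_bound P := 4 * half_line_bound / P + 2 * half_line_bound.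

Lemma slope_bound_ge0 P : 0 < P -> 0 <= slope_bound P.
Proof. by move=> P0; rewrite addr_ge0 ?divr_ge0 ?mulr_ge0 ?half_line_bound_ge0 ?ltW. Qed.

(** The slope lies between the difference quotients towards 0 and towards 2, whose denominators are
    at least [P / 2] and 1. *)
Lemma norm_slope_le P x : 0 < P -> P / 2 <= x <= 1 -> `|slope x| <= slope_bound P.
Proof.
move=> P0 /andP[Px x1]; have x0 : 0 < x by lra.
have M0 := half_line_bound_ge0.
have b0 : `|phi 0| <= half_line_bound by apply: phi_bound; lra.
have b2 : `|phi 2| <= half_line_bound by apply: phi_bound; lra.
have bx : `|phi x| <= half_line_bound by apply: phi_bound; lra.
move: b0 b2 bx; rewrite !ler_norml /slope_bound; set M := half_line_bound in M0 *.
move=> /andP[l0 u0] /andP[l2 u2] /andP[lx ux].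
have MP0 : 0 <= 4 * M / P by rewrite divr_ge0 ?mulr_ge0 // ltW.
apply/andP; split.
  have := slope_ge (lexx 0) x0; rewrite subr0 => /(le_trans _); apply.
  rewrite ler_pdivlMr //.
  have : 2 * M <= 4 * M / P * x.
    have : 4 * M / P * (P / 2) <= 4 * M / P * x by rewrite ler_wpM2l.
    by have -> : 4 * M / P * (P / 2) = 2 * M by field; rewrite gt_eqF.
  by have := mulr_ge0 M0 (ltW x0); lra.
have x2 : x < 2 by lra.
apply: le_trans (slope_le x0 x2) _.
rewrite ler_pdivrMr ?subr_gt0 //.
have : 0 <= 4 * M / P * (2 - x) by rewrite mulr_ge0 //; lra.
have : 0 <= M * (1 - x) by rewrite mulr_ge0 //; lra.
lra.
Qed.

Definition excess_bound P := 2 * half_line_bound + 2 * slope_bound P.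

Lemma excess_bound_ge0 P : 0 < P -> 0 <= excess_bound P.
Proof.
by move=> P0; rewrite addr_ge0 ?mulr_ge0 ?half_line_bound_ge0 ?slope_bound_ge0.
Qed.

Lemma excess_le P x z : 0 < P -> P / 2 <= x <= 1 -> 0 <= z <= 2 ->
  excess x z <= excess_bound P.
Proof.
move=> P0 Px z02; have := norm_slope_le P0 Px.
have /phi_bound : 0 <= x <= 2 by lra.
have /phi_bound := z02.
rewrite /excess_bound /excess !ler_norml => /andP[_ uz] /andP[lx _] sx.
have : - (slope x * (z - x)) <= slope_bound P * 2.
  apply: le_trans (ler_norm _) _; rewrite normrN normrM ler_pM ?ler_norml //; lra.
lra.
Qed.

(** Only chords that straddle [P] must be strict, so a kink such as that of the absolute value at
    [P] qualifies. *)
Definition strictly_convex_at P := forall a b lam,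
  0 <= a -> a < P -> P < b -> 0 < lam < 1 ->
  phi (lam * a + (1 - lam) * b) < lam * phi a + (1 - lam) * phi b.

(** A convex combination of the two excesses, weighted so that its points average to [x], is the
    height of the chord over [phi x], since the supporting line cancels. Strictness at [P - eps / 2]
    and [P + eps / 2], with convexity between them, bounds this height uniformly in [x]. *)
Lemma excess_sum_ge P eps : strictly_convex_at P -> 0 < eps -> eps <= P ->
  exists c, 0 < c /\ forall x, 0 < x -> `|x - P| <= eps / 2 ->
    c <= excess x (P - eps) + excess x (P + eps).
Proof.
move=> sc e0 eP; have a0 : 0 <= P - eps by lra.
have aP : P - eps < P by lra.
have Pb : P < P + eps by lra.
have h34 : 0 < (3 / 4 : R) < 1 by lra.
have h14 : 0 < (1 / 4 : R) < 1 by lra.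
have s1 := sc _ _ _ a0 aP Pb h34; have s2 := sc _ _ _ a0 aP Pb h14.
have E1 : 3 / 4 * (P - eps) + (1 - 3 / 4) * (P + eps) = P - eps / 2 by field.
have E2 : 1 / 4 * (P - eps) + (1 - 1 / 4) * (P + eps) = P + eps / 2 by field.
rewrite E1 in s1; rewrite E2 in s2 => {E1 E2}.
set fa := phi (P - eps) in s1 s2; set fb := phi (P + eps) in s1 s2.
pose d1 := 3 / 4 * fa + (1 - 3 / 4) * fb - phi (P - eps / 2).
pose d2 := 1 / 4 * fa + (1 - 1 / 4) * fb - phi (P + eps / 2).
exists (Order.min d1 d2); split; first by rewrite lt_min !subr_gt0 s1 s2.
move=> x x0; rewrite ler_norml => /andP[xl xr].
have ea := excess_ge0 x0 a0; have eb : 0 <= excess x (P + eps) by apply: excess_ge0 => //; lra.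
pose mu := (P + eps / 2 - x) / eps.
have mu01 : 0 <= mu <= 1 by rewrite divr_ge0 ?ler_pdivrMr //=; lra.
have xE : x = P + eps / 2 - mu * eps by rewrite /mu; field; rewrite gt_eqF.
have p1 : 0 <= P - eps / 2 by lra.
have p2 : 0 <= P + eps / 2 by lra.
have := cvx p1 p2 mu01.
have -> : mu * (P - eps / 2) + (1 - mu) * (P + eps / 2) = x by rewrite xE; field.
have m1 : Order.min d1 d2 <= d1 by rewrite ge_min lexx.
have m2 : Order.min d1 d2 <= d2 by rewrite ge_min lexx orbT.
case/andP: mu01 => mu0 mu1; have mu1' : 0 <= 1 - mu by lra.
have := ler_wpM2l mu0 m1; have := ler_wpM2l mu1' m2.
(* [mu] locates [x] between [P + eps / 2] and [P - eps / 2]; [lam] is the matching weight between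
   the outer points [P + eps] and [P - eps]. *)
pose lam := 1 / 4 + mu / 2.
have l0 : 0 <= lam by rewrite /lam; lra.
have l1 : 0 <= 1 - lam by rewrite /lam; lra.
have := mulr_ge0 l1 ea; have := mulr_ge0 l0 eb.
have : lam * excess x (P - eps) + (1 - lam) * excess x (P + eps) =
  lam * fa + (1 - lam) * fb - phi x.
  have lamx : lam * (P - eps) + (1 - lam) * (P + eps) = x by rewrite xE /lam; field.
  transitivity (lam * fa + (1 - lam) * fb - phi x -
    slope x * (lam * (P - eps) + (1 - lam) * (P + eps) - x)).
    by rewrite /excess -/fa -/fb; ring.
  by rewrite lamx subrr mulr0 subr0.
by rewrite /d1 /d2 /lam; lra.
Qed.

(* Jensen's inequality before averaging: [x] and [u] are the estimates before projection, [xh]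
   and [uh] after it, and [gx], [gu] say that the projection leaves them unchanged. *)
Lemma projected_gap_ge P B : 0 < P -> 0 <= B ->
  exists C, 0 <= C /\ forall (a b x u xh uh : R) (gx gu near : bool),
    0 <= a -> a < b -> b <= 2 -> 0 <= xh <= 1 -> 0 <= uh <= 1 ->
    `|x| <= B -> `|u| <= B ->
    (gx -> P / 2 <= x /\ xh = x) -> (gu -> uh = u) ->
    (near -> [/\ gx, a <= x & x <= b]) ->
    gx%:R * (slope x * (u - x)) +
    near%:R * (excess x a * (u <= a)%R%:R + excess x b * (b <= u)%R%:R)
    - C * ((~~ gx)%:R + (~~ gu)%:R) <= phi uh - phi xh.
Proof.
move=> P0 B0; have M0 := half_line_bound_ge0; have L0 := slope_bound_ge0 P0.
(* The three terms pay for the difference of the [phi] values, for the slope term and for the two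
   excesses, whenever a projection may act. *)
exists (2 * half_line_bound + 2 * slope_bound P * B + 2 * excess_bound P).
have E0 := excess_bound_ge0 P0; have LB := mulr_ge0 L0 B0.
split; first by lra.
move=> a b x u xh uh gx gu near a0 ab b2 xh01 uh01 xB uB gxE guE nE.
have /phi_bound : 0 <= xh <= 2 by lra.
have /phi_bound : 0 <= uh <= 2 by lra.
rewrite !ler_norml => /andP[ul uu] /andP[xl xr].
case: gx gxE nE => [/(_ isT)[Px xhE] nE|_ nE]; last first.
  have -> : near = false by apply/negP => /nE[].
  by rewrite /= !mul0r; case: gu {guE} => /=; lra.
have Px1 : P / 2 <= x <= 1 by rewrite Px -xhE; lra.
have x0 : 0 < x by lra.
have ea0 := excess_ge0 x0 a0.
have eb0 : 0 <= excess x b by apply: excess_ge0 => //; lra.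
subst xh; case: gu guE => [/(_ isT) uhE|_] /=.
  subst uh; rewrite mul1r addr0 mulr0 subr0 -lerBrDl -[leRHS]/(excess x u).
  have u0 : 0 <= u by lra.
  (* With both estimates unprojected, what remains on the right is [excess x u], and at most one of
     the two excursions occurs since [a < b]. *)
  have eu0 := excess_ge0 x0 u0.
  case: near nE => [/(_ isT)[_ ax xb]|_]; last by rewrite mul0r.
  rewrite mul1r; case: (lerP u a) => ua; case: (lerP b u) => bu; rewrite ?mulr0 ?mulr1 ?addr0 ?add0r //.
  - by lra.
  - exact: excess_antitone_left.
  - exact: excess_monotone_right.
have ea := excess_le P0 Px1; have /ea eaB : 0 <= a <= 2 by lra.
have /ea ebB : 0 <= b <= 2 by lra.
have : slope x * (u - x) <= slope_bound P * (2 * B).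
  apply: le_trans (ler_norm _) _; rewrite normrM ler_pM ?norm_slope_le //.
  by apply: le_trans (ler_normB _ _) _; lra.
have : near%:R * (excess x a * (u <= a)%R%:R + excess x b * (b <= u)%R%:R) <= 2 * excess_bound P.
  by case: near {nE}; case: (u <= a); case: (b <= u); rewrite ?mulr0 ?mulr1 ?mul0r ?mul1r; lra.
lra.
Qed.

End SupportingLine.

(** * Channels *)

Section Channels.
Context {R : realType} {K : nat}.
Implicit Types (p q : 'rV[R]_K) (V A B : 'M[R]_K).

Definition joint q V (t : 'I_K * 'I_K) : R := q 0 t.1 * V t.1 t.2.

Definition inputs n (w : {ffun 'I_n -> 'I_K * 'I_K}) : {ffun 'I_n -> 'I_K} :=
  [ffun i => (w i).1].

Definition outputs n (w : {ffun 'I_n -> 'I_K * 'I_K}) : {ffun 'I_n -> 'I_K} :=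
  [ffun i => (w i).2].

Lemma sum_fst_fiber (F : 'I_K * 'I_K -> R) s : \sum_(t | t.1 == s) F t = \sum_j F (s, j).
Proof.
rewrite (eq_bigl (fun t => (t.1 == s) && true)) => [|t]; last by rewrite andbT.
rewrite (eq_bigr (fun t => F (t.1, t.2))) => [|[i j]] //.
by rewrite -(pair_big_dep (fun i => i == s) (fun _ _ => true) (fun i j => F (i, j))) big_pred1_eq.
Qed.

Lemma sum_snd_fiber (F : 'I_K * 'I_K -> R) s : \sum_(t | t.2 == s) F t = \sum_i F (i, s).
Proof.
rewrite (eq_bigr (fun t => F (t.1, t.2))) => [|[i j]] //.
rewrite -(pair_big_dep (fun _ => true) (fun _ j => j == s) (fun i j => F (i, j))) /=.
by apply: eq_bigr => i _; rewrite big_pred1_eq.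
Qed.

Lemma joint_ge0 q V : in_simplex q -> row_stochastic V -> forall t, 0 <= joint q V t.
Proof. by move=> [q0 _] [V0 _] t; rewrite mulr_ge0. Qed.

Lemma joint_sum q V : in_simplex q -> row_stochastic V -> \sum_t joint q V t = 1.
Proof.
move=> [_ q1] [_ V1].
transitivity (\sum_i \sum_j q 0 i * V i j); first by rewrite pair_bigA.
rewrite -q1.
apply: eq_bigr => i _.
by rewrite -mulr_sumr /= V1 mulr1.
Qed.

Lemma joint_input_mean q V A k : row_stochastic V ->
  \sum_t joint q V t * A t.1 k = (q *m A) 0 k.
Proof.
move=> [_ V1]; transitivity (\sum_i \sum_j q 0 i * V i j * A i k); first by rewrite pair_bigA.
rewrite mxE.
by apply: eq_bigr => i _; rewrite -mulr_suml -mulr_sumr /= V1 mulr1.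
Qed.

Lemma joint_output_mean q V B k : \sum_t joint q V t * B t.2 k = (q *m (V *m B)) 0 k.
Proof.
transitivity (\sum_i \sum_j q 0 i * V i j * B j k); first by rewrite pair_bigA.
rewrite mxE.
apply: eq_bigr => i _; rewrite mxE mulr_sumr /=.
by apply: eq_bigr => j _; rewrite mulrA.
Qed.

Lemma eq_iid_expect (T : finType) (mu nu : T -> R) n (g : {ffun 'I_n -> T} -> R) :
  mu =1 nu -> iid_expect mu g = iid_expect nu g.
Proof.
move=> mn; apply: eq_bigr => w _; congr (_ * _).
by apply: eq_bigr => i _; rewrite mn.
Qed.

Lemma iid_expect_inputs q V n (g : {ffun 'I_n -> 'I_K} -> R) : row_stochastic V ->
  iid_expect (joint q V) (fun w => g (inputs w)) = iid_expect (q 0) g.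
Proof.
move=> [_ V1]; rewrite (iid_expect_map _ fst); apply: eq_iid_expect => l.
by rewrite /pushforward sum_fst_fiber /joint /= -mulr_sumr /= V1 mulr1.
Qed.

Lemma iid_expect_outputs q V n (g : {ffun 'I_n -> 'I_K} -> R) :
  iid_expect (joint q V) (fun w => g (outputs w)) = iid_expect ((q *m V) 0) g.
Proof.
rewrite (iid_expect_map _ snd); apply: eq_iid_expect => l.
by rewrite /pushforward sum_snd_fiber mxE.
Qed.

(** The expectation depends on [p] and [V] only through the output law. This freedom allows the
    samples of the two channels to be coupled through [joint]. *)
Lemma expectE p V n (g : {ffun 'I_n -> 'I_K} -> R) :
  expect p V g = iid_expect ((p *m V) 0) g.
Proof. by rewrite -iid_expect_outputs. Qed.

(** Grouping the indices by letter makes each unprojected coordinate a sample mean, to which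
    concentration applies. *)
Lemma empirical_mulmx n (y : {ffun 'I_n -> 'I_K}) A k :
  (empirical R y *m A) 0 k = sample_mean (A^~ k) y.
Proof.
rewrite mxE /sample_mean (partition_big y xpredT) //= mulr_suml /=.
apply: eq_bigr => l _; rewrite mxE mulrAC; congr (_ * _).
rewrite (eq_bigr (fun=> A l k)); last by move=> i /eqP ->.
rewrite (eq_bigl (mem [set i | y i == l])); last by move=> i; rewrite /= inE.
by rewrite sumr_const mulr_natl.
Qed.

Lemma sample_mean_row_sum n (y : {ffun 'I_n -> 'I_K}) A : (0 < n)%N ->
  (forall l, \sum_k A l k = 1) -> \sum_k sample_mean (A^~ k) y = 1.
Proof.
move=> n0 A1; rewrite -mulr_suml exchange_big /=.
rewrite (eq_bigr (fun=> 1)) => [|i _]; last exact: A1.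
by rewrite sumr_const card_ord divff // pnatr_eq0 -lt0n.
Qed.

Lemma sample_mean_inputs A k n (w : {ffun 'I_n -> 'I_K * 'I_K}) :
  sample_mean (A^~ k) (inputs w) = sample_mean (fun t => A t.1 k) w.
Proof. exact: sample_mean_map. Qed.

Lemma sample_mean_outputs A k n (w : {ffun 'I_n -> 'I_K * 'I_K}) :
  sample_mean (A^~ k) (outputs w) = sample_mean (fun t => A t.2 k) w.
Proof. exact: sample_mean_map. Qed.

(** [V *m B = A] says that, given an input letter, the mean of the [B] entry at the output is the
    [A] entry at the input. Each summand of the difference is therefore conditionally centered. *)
Lemma iid_expect_martingale q V A B n k (g : {ffun 'I_n -> 'I_K} -> R) :
  row_stochastic V -> V *m B = A ->
  iid_expect (joint q V) (fun w => g (inputs w) *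
    (sample_mean (B^~ k) (outputs w) - sample_mean (A^~ k) (inputs w))) = 0.
Proof.
move=> [_ V1] VB.
pose X (t : 'I_K * 'I_K) := n%:R^-1 * (B t.2 k - A t.1 k).
transitivity (iid_expect (joint q V)
    (fun w : {ffun 'I_n -> _} => \sum_i g [ffun i => (w i).1] * X (w i))).
  apply: eq_bigr => w _; congr (_ * _).
  rewrite -mulr_sumr /= -mulr_sumr /= sumrB; congr (_ * _).
  rewrite sample_mean_inputs sample_mean_outputs /sample_mean.
  by rewrite -mulrBl mulrC.
rewrite iid_expect_sum big1 // => i _; apply: iid_expect_centered => s.
rewrite sum_fst_fiber /joint /X /=.
rewrite (eq_bigr (fun j => q 0 s * n%:R^-1 * (V s j * B j k - V s j * A s k))); last first.
  by move=> j _; ring.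
rewrite -mulr_sumr /= sumrB -mulr_suml /= V1 mul1r -VB mxE subrr mulr0 //.
Qed.

Definition tilt V l j1 j2 (tau : R) : 'M[R]_K :=
  V + tau *: (delta_mx l j1 - delta_mx l j2).

Lemma tiltE V l j1 j2 tau i j : tilt V l j1 j2 tau i j =
  V i j + tau * (((i == l) && (j == j1))%:R - ((i == l) && (j == j2))%:R).
Proof. by rewrite !mxE. Qed.

Lemma tilt_ge0 V l j1 j2 tau : (forall i j, 0 <= V i j) -> 0 <= tau ->
  tau <= V l j2 -> forall i j, 0 <= tilt V l j1 j2 tau i j.
Proof.
move=> V0 t0 tV i j; rewrite tiltE.
have := V0 i j; case: (i =P l) => [->|_] /=; last lra.
by case: (j =P j2) => [->|_]; case: (_ == _) => /=; lra.
Qed.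

Lemma tilt_row_stochastic V l j1 j2 tau : row_stochastic V -> 0 <= tau ->
  tau <= V l j2 -> row_stochastic (tilt V l j1 j2 tau).
Proof.
move=> [V0 V1] t0 tV; split; first exact: tilt_ge0.
move=> i; rewrite (eq_bigr (fun j => V i j + tau *
   (((i == l) && (j == j1))%:R - ((i == l) && (j == j2))%:R))); last by move=> j _; rewrite tiltE.
rewrite big_split /= V1 -mulr_sumr /= sumrB.
have one j0 : \sum_j ((i == l) && (j == j0))%:R = (i == l)%:R :> R.
  rewrite (bigD1 j0) //= eqxx andbT big1 ?addr0 // => j /negbTE ->.
  by rewrite andbF.
by rewrite !one subrr mulr0 addr0.
Qed.

(** Only the entry at [(l, j1)] can grow, and by at most the fraction [1 - rho] of itself because
    [m <= V l j1]; the factor [rho] absorbs this. *)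
Lemma tilt_dominated V l j1 j2 rho m : (forall i j, 0 <= V i j) -> 0 <= rho <= 1 -> 0 <= m ->
  m <= V l j1 -> m <= V l j2 ->
  forall i j, rho * tilt V l j1 j2 ((1 - rho) * m) i j <= V i j.
Proof.
move=> V0 /andP[r0 r1] m0 m1 m2 i j; rewrite tiltE mulrDr.
have rV : rho * V i j <= V i j by rewrite ler_piMl.
have rm : 0 <= rho * ((1 - rho) * m) by rewrite !mulr_ge0 // subr_ge0.
case: (i =P l) => [il|_] /=; last by rewrite subrr !mulr0 addr0.
subst i; case: (j =P j1) => [jl|_]; last by case: (_ == _) => /=; lra.
subst j; have : rho * ((1 - rho) * m) <= (1 - rho) * V l j1.
  rewrite mulrCA ler_wpM2l ?subr_ge0 //; apply: le_trans m1; exact: ler_piMl.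
by case: (_ == _) => /=; lra.
Qed.

Lemma tilt_output_mean q V B l j1 j2 tau k :
  (q *m (tilt V l j1 j2 tau *m B)) 0 k =
  (q *m (V *m B)) 0 k + tau * (q 0 l * (B j1 k - B j2 k)).
Proof.
have row j : (q *m (delta_mx l j *m B)) 0 k = q 0 l * B j k.
  rewrite mxE (bigD1 l) //= big1 ?addr0 => [|i /negbTE il].
    congr (_ * _); rewrite mxE (bigD1 j) //= big1 ?addr0 => [|i /negbTE ij].
      by rewrite mxE !eqxx mul1r.
    by rewrite mxE ij andbF mul0r.
  by rewrite mxE big1 ?mulr0 // => j' _; rewrite mxE il mul0r.
rewrite mulmxDl mulmxDr mxE; congr (_ + _).
rewrite -scalemxAl -scalemxAr mulmxBl mulmxBr mxE; congr (_ * _).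
by rewrite mulrBr -!row !mxE.
Qed.

End Channels.

(** * The loss gap *)

Section LossGap.
Context {R : realType} {K : nat}.
Implicit Types (M A B : 'M[R]_K).
Variables (p : 'rV[R]_K) (Proj : 'rV[R]_K -> 'rV[R]_K).
Hypotheses (p_simplex : in_simplex p) (p_gt0 : forall k, 0 < p 0 k).
Hypothesis projP : simplex_projection Proj.

Definition estimate M n (y : {ffun 'I_n -> 'I_K}) : 'rV[R]_K := Proj (empirical R y *m M).

(* On this event the unprojected estimate lies in the simplex. *)
Definition regular M n (y : {ffun 'I_n -> 'I_K}) : bool :=
  [forall k, `|sample_mean (M^~ k) y - p 0 k| < p 0 k / 2].

Lemma p_le1 k : p 0 k <= 1.
Proof. by case: p_simplex => p0 <-; rewrite (bigD1 k) //= lerDl sumr_ge0. Qed.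

Section Estimate.
Context {n : nat} (n_gt0 : (0 < n)%N) (y : {ffun 'I_n -> 'I_K}) (M : 'M[R]_K).
Hypothesis M_sum : forall l, \sum_k M l k = 1.

Lemma unprojected_sum : \sum_k (empirical R y *m M) 0 k = 1.
Proof.
rewrite -(sample_mean_row_sum y n_gt0 M_sum).
by apply: eq_bigr => k _; exact: empirical_mulmx.
Qed.

Lemma estimate_01 k : 0 <= estimate M y 0 k <= 1.
Proof.
have [e0 e1] := projP.1 _ unprojected_sum.
by rewrite e0 -e1 /= (bigD1 k) //= lerDl sumr_ge0.
Qed.

Lemma regular_ge k : regular M y -> p 0 k / 2 <= sample_mean (M^~ k) y.
Proof. by move=> /forallP/(_ k); rewrite ltr_norml => /andP[]; lra. Qed.

Lemma estimate_regular k : regular M y -> estimate M y 0 k = sample_mean (M^~ k) y.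
Proof.
move=> reg; rewrite /estimate projP.2 ?empirical_mulmx //.
split; last exact: unprojected_sum.
move=> j; rewrite empirical_mulmx; apply: le_trans (regular_ge j reg).
by rewrite divr_ge0 ?ltW.
Qed.

End Estimate.

(** Union bound over the coordinates. The map [h] lets the same statement serve the inputs and the
    outputs of a joint sample. *)
Lemma irregular_exp_small (T : finType) (mu : T -> R) (h : T -> 'I_K) M :
  (forall t, 0 <= mu t) -> \sum_t mu t = 1 ->
  (forall k, \sum_t mu t * M (h t) k = p 0 k) ->
  exp_small (fun n => iid_expect mu
    (fun w : {ffun 'I_n -> T} => (~~ regular M [ffun i => h (w i)])%:R)).
Proof.
move=> mu0 mu1 mean.
have half k : 0 < p 0 k / 2 by rewrite divr_gt0.
apply: exp_small_le (exp_small_sum (fun k => deviation mu0 mu1 (mean k) (half k))) => n.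
rewrite -iid_expect_sum; apply: iid_expect_le => // w.
have ge0 k : 0 <= (p 0 k / 2 <= `|sample_mean (fun t => M (h t) k) w - p 0 k|)%R%:R :> R by [].
case: (boolP (regular _ _)) => [_|]; first exact: sumr_ge0.
rewrite negb_forall => /existsP[k]; rewrite -leNgt => dev.
rewrite (bigD1 k) //= ler_wpDr ?sumr_ge0 //.
by rewrite sample_mean_map in dev; rewrite ler_nat dev.
Qed.

(** In the application [q] is the output law of the first channel, [V] the second channel, and [A],
    [B] the inverses of the first and of the composed channel. [x] and [u] below are the unprojected
    estimates built from the inputs and outputs of [V]. *)
Variables (q : 'rV[R]_K) (V A B : 'M[R]_K) (phi : 'I_K -> R -> R).
Hypotheses (q_simplex : in_simplex q) (q_gt0 : forall l, 0 < q 0 l).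
Hypothesis V_stoch : row_stochastic V.
Hypotheses (qA : q *m A = p) (VB : V *m B = A).
Hypotheses (A_sum : forall l, \sum_k A l k = 1) (B_sum : forall l, \sum_k B l k = 1).
Hypothesis phi_convex : forall k, convex_nonneg (phi k).
Variables (l0 j1 j2 k0 : 'I_K).
Hypotheses (V1_gt0 : 0 < V l0 j1) (V2_gt0 : 0 < V l0 j2) (B_lt : B j1 k0 < B j2 k0).
Hypothesis phi_strict : strictly_convex_at (phi k0) (p 0 k0).

Let P := p 0 k0.
Let x n (w : {ffun 'I_n -> 'I_K * 'I_K}) k := sample_mean (A^~ k) (inputs w).
Let u n (w : {ffun 'I_n -> 'I_K * 'I_K}) k := sample_mean (B^~ k) (outputs w).

Definition near_target eps n (y : {ffun 'I_n -> 'I_K}) : bool :=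
  regular A y && (`|sample_mean (A^~ k0) y - P| <= eps / 2).

(** The part of the Jensen gap that is kept: coordinate [k0] only, with [x] close to [P] while [u]
    leaves the window of radius [eps]. *)
Definition kink_gain eps n (w : {ffun 'I_n -> 'I_K * 'I_K}) : R :=
  (near_target eps (inputs w))%:R *
  (excess (phi k0) (x w k0) (P - eps) * (u w k0 <= P - eps)%R%:R +
   excess (phi k0) (x w k0) (P + eps) * (P + eps <= u w k0)%R%:R).

Definition irregularity n (w : {ffun 'I_n -> 'I_K * 'I_K}) : R :=
  (~~ regular A (inputs w))%:R + (~~ regular B (outputs w))%:R.

Lemma sample_mean_bounded M : exists b : R, 0 <= b /\
  forall n (y : {ffun 'I_n -> 'I_K}) k, `|sample_mean (M^~ k) y| <= b.
Proof.
have [b [b0 Mb]] := finite_bound (fun t : 'I_K * 'I_K => M t.1 t.2).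
exists b; split=> [|n y k]; first exact: ltW.
by apply: sample_mean_bound => [|l]; [exact: ltW | exact: (Mb (l, k))].
Qed.

(** Sum the pointwise inequality over the coordinates and average. The slope multiplies a martingale
    difference by a function of the inputs, so it averages to zero. The constant is uniform in [eps]
    and [n]. *)
Lemma loss_gap_ge : exists C : R, 0 <= C /\ forall (eps : R) n, (0 < n)%N -> 0 < eps -> eps <= P ->
  iid_expect (joint q V) (fun w : {ffun 'I_n -> _} => kink_gain eps w)
  - C * iid_expect (joint q V) (@irregularity n)
  <= iid_expect ((q *m V) 0)
       (fun z : {ffun 'I_n -> 'I_K} => \sum_k phi k (estimate B z 0 k))
   - iid_expect (q 0)
       (fun y : {ffun 'I_n -> 'I_K} => \sum_k phi k (estimate A y 0 k)).
Proof.
have [bA [bA0 xA]] := sample_mean_bounded A.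
have [bB [bB0 uB]] := sample_mean_bounded B.
have b0 : 0 <= bA + bB by rewrite addr_ge0.
have /fin_all_exists[C CP] k := projected_gap_ge (phi_convex k) (p_gt0 k) b0.
exists (\sum_k C k); split=> [|eps n n0 e0 eP].
  by apply: sumr_ge0 => k _; case: (CP k).
rewrite -(iid_expect_inputs q _ V_stoch) -iid_expect_outputs -iid_expectB -iid_expectZ -iid_expectB.
pose g k (y : {ffun 'I_n -> 'I_K}) : R := (regular A y)%:R * slope (phi k) (sample_mean (A^~ k) y).
have mart : iid_expect (joint q V) (fun w : {ffun 'I_n -> _} =>
    \sum_k g k (inputs w) * (u w k - x w k)) = 0.
  rewrite iid_expect_sum big1 // => k _.
  exact: (iid_expect_martingale q k (g k) V_stoch VB).
rewrite -[leLHS]addr0 -[X in _ + X]mart -iid_expectD.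
apply: iid_expect_le => [|w]; first exact: joint_ge0.
rewrite -sumrB.
pose lin k := g k (inputs w) * (u w k - x w k) - C k * irregularity w.
have gap k (a b : R) (near : bool) : 0 <= a -> a < b -> b <= 2 ->
    (near -> [/\ regular A (inputs w), a <= x w k & x w k <= b]) ->
    lin k + near%:R * (excess (phi k) (x w k) a * (u w k <= a)%R%:R +
                       excess (phi k) (x w k) b * (b <= u w k)%R%:R) <=
    phi k (estimate B (outputs w) 0 k) - phi k (estimate A (inputs w) 0 k).
  move=> a0 ab b2 nearP.
  have := (CP k).2 a b (x w k) (u w k) _ _ (regular A (inputs w)) (regular B (outputs w)) near
    a0 ab b2 (estimate_01 n0 (inputs w) A_sum k) (estimate_01 n0 (outputs w) B_sum k).
  rewrite /lin /g -/(x w k) -mulrA => h; apply: le_trans (h _ _ _ _ nearP).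
  - by rewrite addrAC.
  - by apply: le_trans (xA _ _ _) _; rewrite lerDl.
  - by apply: le_trans (uB _ _ _) _; rewrite lerDr.
  - by move=> reg; split; [exact: regular_ge | exact: estimate_regular].
  - by move=> reg; exact: estimate_regular.
have gapS : \sum_k lin k + kink_gain eps w <=
    \sum_k (phi k (estimate B (outputs w) 0 k) - phi k (estimate A (inputs w) 0 k)).
  rewrite (bigD1 k0) //= [leRHS](bigD1 k0) //= addrAC; apply: lerD.
    apply: gap; rewrite ?subr_ge0 //; first lra.
      by have := p_le1 k0; rewrite -/P; lra.
    by move=> /andP[reg]; rewrite ler_norml => /andP[xl xr]; split=> //; rewrite /x; lra.
  apply: ler_sum => k _.
  (* Away from [k0] no gain is claimed; 0 and 1 are placeholders for the window. *)
  by have := gap k 0 1 false (lexx _) ltr01; rewrite mul0r addr0; apply; rewrite ?ler1n.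
apply: le_trans gapS.
rewrite /lin sumrB -mulr_suml; lra.
Qed.

Lemma exp_small_irregularity :
  exp_small (fun n => iid_expect (joint q V) (@irregularity n)).
Proof.
have J0 := joint_ge0 q_simplex V_stoch; have J1 := joint_sum q_simplex V_stoch.
have mA k : \sum_t joint q V t * A t.1 k = p 0 k by rewrite joint_input_mean // qA.
have mB k : \sum_t joint q V t * B t.2 k = p 0 k by rewrite joint_output_mean VB qA.
apply: exp_small_le (exp_smallD (irregular_exp_small J0 J1 mA) (irregular_exp_small J0 J1 mB)) => n.
by rewrite -iid_expectD.
Qed.

(* The two rare events [u <= P - eps] and [P + eps <= u] become typical under channels that are
   tilted by a small amount, at the price of a factor [rho ^+ n] in the probability. *)
Lemma kink_gain_ge rho : 0 < rho < 1 -> exists (eps c : R) (a : nat -> R),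
  [/\ 0 < eps, eps <= P, 0 < c, exp_small a &
   forall n, (0 < n)%N -> rho ^+ n * (c - a n) <= iid_expect (joint q V) (fun w : {ffun 'I_n -> _} => kink_gain eps w)].
Proof.
move=> /andP[rho0 rho1].
pose m := Order.min (V l0 j1) (V l0 j2).
have m0 : 0 < m by rewrite lt_min V1_gt0.
have m1 : m <= V l0 j1 by rewrite ge_min lexx.
have m2 : m <= V l0 j2 by rewrite ge_min lexx orbT.
(* The largest shift for which [tilt_dominated] gives the factor [rho]. *)
pose tau := (1 - rho) * m.
have tau0 : 0 < tau by rewrite mulr_gt0 ?subr_gt0.
have taum : tau <= m by rewrite /tau ler_piMl ?ltW //; lra.
(* As [B j1 k0 < B j2 k0], moving mass to [j1] lowers the mean of [u] at [k0], and moving it to [j2]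
   raises it; both shifts equal [delta]. *)
pose Vlo := tilt V l0 j1 j2 tau; pose Vhi := tilt V l0 j2 j1 tau.
have Vlo_stoch : row_stochastic Vlo.
  by apply: tilt_row_stochastic (le_trans taum m2) => //; exact: ltW.
have Vhi_stoch : row_stochastic Vhi.
  by apply: tilt_row_stochastic (le_trans taum m1) => //; exact: ltW.
have rho01 : 0 <= rho <= 1 by lra.
have V0 := V_stoch.1.
have dom_lo t : rho * joint q Vlo t <= joint q V t.
  by rewrite mulrCA ler_wpM2l ?q_simplex.1 // tilt_dominated // ltW.
have dom_hi t : rho * joint q Vhi t <= joint q V t.
  by rewrite mulrCA ler_wpM2l ?q_simplex.1 // tilt_dominated // ltW.
have J0 := joint_ge0 q_simplex V_stoch; have J1 := joint_sum q_simplex V_stoch.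
have lo0 := joint_ge0 q_simplex Vlo_stoch; have lo1 := joint_sum q_simplex Vlo_stoch.
have hi0 := joint_ge0 q_simplex Vhi_stoch; have hi1 := joint_sum q_simplex Vhi_stoch.
pose delta := tau * (q 0 l0 * (B j2 k0 - B j1 k0)).
have delta0 : 0 < delta by rewrite !mulr_gt0 // subr_gt0.
have mean_lo : \sum_t joint q Vlo t * B t.2 k0 = P - delta.
  by rewrite joint_output_mean tilt_output_mean VB qA /delta /P; ring.
have mean_hi : \sum_t joint q Vhi t * B t.2 k0 = P + delta.
  by rewrite joint_output_mean tilt_output_mean VB qA /delta /P.
(* The tilted means are [P - delta] and [P + delta], so a fluctuation below [delta / 2] still leaves
   [u] outside the window; [eps <= P] keeps [P - eps] in the domain. *)
pose eps := Order.min (delta / 2) P.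
have eps0 : 0 < eps by rewrite lt_min p_gt0 divr_gt0.
have epsP : eps <= P by rewrite ge_min lexx orbT.
have epsd : eps <= delta / 2 by rewrite ge_min lexx.
have d2 : 0 < delta / 2 by rewrite divr_gt0.
have e2 : 0 < eps / 2 by rewrite divr_gt0.
have [c [c0 cP]] := excess_sum_ge (phi_convex k0) phi_strict eps0 epsP.
pose E := excess_bound (phi k0) P.
have E0 : 0 <= E by exact: excess_bound_ge0 (p_gt0 k0).
pose elo n (w : {ffun 'I_n -> 'I_K * 'I_K}) : R := (P - delta + delta / 2 <= sample_mean (fun t => B t.2 k0) w)%R%:R.
pose ehi n (w : {ffun 'I_n -> 'I_K * 'I_K}) : R := (sample_mean (fun t => B t.2 k0) w <= P + delta - delta / 2)%R%:R.
pose edev n (w : {ffun 'I_n -> 'I_K * 'I_K}) : R := (eps / 2 <= `|sample_mean (fun t => A t.1 k0) w - P|)%R%:R.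
(* Losing an excursion costs at most the excess bound [E]; losing the closeness of [x] to [P] costs
   at most [c]. *)
pose a n := E * (iid_expect (joint q Vlo) (@elo n) + iid_expect (joint q Vhi) (@ehi n))
  + c * (iid_expect (joint q V) (fun w : {ffun 'I_n -> _} => (~~ regular A (inputs w))%:R)
         + iid_expect (joint q V) (@edev n)).
exists eps, c, a; split=> //.
  have mA k : \sum_t joint q V t * A t.1 k = p 0 k by rewrite joint_input_mean // qA.
  apply: exp_smallD; [apply: exp_smallZ E0 _ | apply: exp_smallZ (ltW c0) _]; apply: exp_smallD.
  - exact: upper_deviation.
  - exact: lower_deviation.
  - exact: irregular_exp_small J0 J1 mA.
  - by apply: deviation => //; exact: mA.
move=> n n0.
pose near (y : {ffun 'I_n -> 'I_K}) : R := (near_target eps y)%:R.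
pose xl (y : {ffun 'I_n -> 'I_K}) := excess (phi k0) (sample_mean (A^~ k0) y) (P - eps).
pose xr (y : {ffun 'I_n -> 'I_K}) := excess (phi k0) (sample_mean (A^~ k0) y) (P + eps).
have P1 : P <= 1 by exact: p_le1.
have P0 : 0 < P by exact: p_gt0.
have nearP y : near_target eps y -> [/\ 0 < sample_mean (A^~ k0) y,
    0 <= xl y <= E, 0 <= xr y <= E & c <= xl y + xr y].
  move=> /andP[reg near_y]; have := regular_ge k0 reg; rewrite -/P => h.
  have y0 : 0 < sample_mean (A^~ k0) y by lra.
  have y1 : P / 2 <= sample_mean (A^~ k0) y <= 1.
    by rewrite h -(estimate_regular n0 A_sum k0 reg); case/andP: (estimate_01 n0 y A_sum k0).
  rewrite /xl /xr !excess_ge0 ?excess_le //=; try lra.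
  by split=> //; exact: cP.
(* Pass to the tilted law [nu], then drop the event [ev], which is typical there, at the cost of [E]
   times its failure [e]. *)
have cut (nu : 'I_K * 'I_K -> R) (f : {ffun 'I_n -> 'I_K} -> R) (ev : {ffun 'I_n -> 'I_K * 'I_K} -> bool) (e : {ffun 'I_n -> 'I_K * 'I_K} -> R) :
    (forall t, 0 <= nu t) -> (forall t, rho * nu t <= joint q V t) ->
    (forall y, near_target eps y -> 0 <= f y <= E) ->
    (forall w, ~~ ev w -> e w = 1) -> (forall w, 0 <= e w) ->
    rho ^+ n * (iid_expect nu (fun w => near (inputs w) * f (inputs w)) - E * iid_expect nu e) <=
    iid_expect (joint q V) (fun w => near (inputs w) * (f (inputs w) * (ev w)%:R)).
  move=> nu0 dom fP eP e_ge0.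
  apply: le_trans (iid_expect_dominated (ltW rho0) nu0 dom _); last first.
    move=> w; rewrite /near; case: (boolP (near_target _ _)) => [/fP/andP[f0 _]|_].
      by rewrite mul1r mulr_ge0.
    by rewrite mul0r.
  rewrite ler_wpM2l ?exprn_ge0 ?(ltW rho0) // -iid_expectZ -iid_expectB.
  apply: iid_expect_le => // w; rewrite /near.
  have Ee : 0 <= E * e w by rewrite mulr_ge0.
  case: (boolP (near_target _ _)) => [/fP/andP[f0 fE]|_]; last by rewrite !mul0r; lra.
  rewrite !mul1r; case: (boolP (ev w)) => [_|/eP ->]; first by rewrite mulr1; lra.
  by rewrite mulr0 mulr1; lra.
have lo := cut (joint q Vlo) xl (fun w => u w k0 <= P - eps) (@elo n) lo0 dom_lo.
have hi := cut (joint q Vhi) xr (fun w => P + eps <= u w k0) (@ehi n) hi0 dom_hi.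
rewrite [X in _ <= X](_ : _ = iid_expect (joint q V) (fun w : {ffun 'I_n -> _} =>
     near (inputs w) * (xl (inputs w) * (u w k0 <= P - eps)%R%:R) +
     near (inputs w) * (xr (inputs w) * (P + eps <= u w k0)%R%:R))); last first.
  by apply: eq_bigr => w _; rewrite -mulrDr.
rewrite iid_expectD.
apply: le_trans (lerD (lo _ _ _) (hi _ _ _)); last first.
- by move=> w; exact: ler0n.
- move=> w; rewrite -ltNge => uw; rewrite /ehi -sample_mean_outputs -/(u w k0).
  by rewrite (_ : _ <= _) //; lra.
- by move=> y /nearP[].
- by move=> w; exact: ler0n.
- move=> w; rewrite -ltNge => uw; rewrite /elo -sample_mean_outputs -/(u w k0).
  by rewrite (_ : _ <= _) //; lra.
- by move=> y /nearP[].
rewrite -mulrDr ler_wpM2l ?exprn_ge0 ?(ltW rho0) //.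
(* Tilting changes the channel but not the input law. Both terms therefore become expectations under
   the same [q], and the two excesses can be added to reach [c]. *)
rewrite !(iid_expect_inputs q (fun y => near y * _ y)) //.
suff : c - c * (iid_expect (joint q V) (fun w : {ffun 'I_n -> _} => (~~ regular A (inputs w))%:R)
         + iid_expect (joint q V) (@edev n)) <=
  iid_expect (q 0) (fun y => near y * xl y) + iid_expect (q 0) (fun y => near y * xr y).
  by rewrite /a; lra.
rewrite -!iid_expectD -(iid_expect_inputs q _ V_stoch) -iid_expectZ.
rewrite -{1}(iid_expect_const n c J1) -iid_expectB.
apply: iid_expect_le => // w; rewrite /edev -sample_mean_inputs -mulrDr /near.
case: (boolP (near_target _ _)) => [/nearP[_ _ _ cx]|].
  by rewrite mul1r; apply: le_trans cx; rewrite gerBl mulr_ge0 ?addr_ge0 // ltW.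
rewrite mul0r /near_target negb_and -ltNge => irr; rewrite subr_le0 ler_peMr ?(ltW c0) //.
case/orP: irr => [->|dev]; first by rewrite lerDl.
by rewrite (ltW dev) lerDr.
Qed.

(** The decay rate [r] of the irregular event is fixed first. Taking [rho] strictly between [r] and
    1 makes the gain, of order [rho ^+ n], dominate the error. *)
Lemma loss_gap_eventually_gt0 : exists N, forall n, (N <= n)%N ->
  iid_expect (q 0) (fun y : {ffun 'I_n -> 'I_K} => \sum_k phi k (estimate A y 0 k)) <
  iid_expect ((q *m V) 0) (fun z : {ffun 'I_n -> 'I_K} => \sum_k phi k (estimate B z 0 k)).
Proof.
have [C [C0 gap]] := loss_gap_ge.
have [D [r [D0 /andP[r0 r1] irr]]] := exp_small_irregularity.
pose rho := (1 + r) / 2.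
have rho0 : 0 < rho by rewrite /rho; lra.
have r_rho : r < rho by rewrite /rho; lra.
have rho01 : 0 < rho < 1 by rewrite rho0 /rho; lra.
have [eps [c [a [eps0 epsP c0 aS kink]]]] := kink_gain_ge rho01.
have c2 : 0 < c / 2 by rewrite divr_gt0.
have [N1 aN1] := exp_small_eventually aS c2.
have ratio : 0 < r / rho < 1 by rewrite divr_gt0 //= ltr_pdivrMr // mul1r.
have [N2 rN2] := geometric_lt (C * D) ratio c2.
(* The sample must be nonempty: the empirical vector of an empty one is zero, and its entries do not
   sum to one. *)
exists (maxn 1 (maxn N1 N2)) => n; rewrite !geq_max => /and3P[n0 /aN1 an /rN2 rn].
rewrite -subr_gt0; apply: lt_le_trans (gap eps n n0 eps0 epsP).
rewrite subr_gt0; apply: lt_le_trans (kink n n0).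
apply: le_lt_trans (ler_wpM2l C0 (irr n)) _.
have -> : r ^+ n = rho ^+ n * (r / rho) ^+ n by rewrite -exprMn mulrC divfK ?gt_eqF.
rewrite [C * _]mulrA [C * D * _]mulrCA.
by rewrite ltr_pM2l ?exprn_gt0 //; lra.
Qed.

End LossGap.

(** * Invertible stochastic matrices and the three losses *)

Section Instances.
Context {R : realType} {K : nat}.
Implicit Types (p : 'rV[R]_K) (V W : 'M[R]_K).

Lemma row_stochastic_mul1 V : (forall l, \sum_k V l k = 1) <->
  V *m const_mx 1 = const_mx 1 :> 'cV[R]_K.
Proof.
split=> [V1|V1 l].
  apply/matrixP => l j; rewrite !mxE -[RHS](V1 l).
  by apply: eq_bigr => k _; rewrite mxE mulr1.
move/matrixP/(_ l 0): V1; rewrite !mxE => <-.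
by apply: eq_bigr => k _; rewrite mxE mulr1.
Qed.

Lemma invmx_row_sum V : V \in unitmx -> row_stochastic V ->
  forall l, \sum_k invmx V l k = 1.
Proof.
move=> uV [_ /row_stochastic_mul1 V1]; apply/row_stochastic_mul1.
by rewrite -[in LHS]V1 mulKmx.
Qed.

Lemma row_stochastic_mul V W : row_stochastic V -> row_stochastic W ->
  row_stochastic (V *m W).
Proof.
move=> [V0 /row_stochastic_mul1 V1] [W0 /row_stochastic_mul1 W1]; split.
  by move=> k l; rewrite mxE sumr_ge0 // => j _; rewrite mulr_ge0.
by apply/row_stochastic_mul1; rewrite -mulmxA W1 V1.
Qed.

Lemma in_simplex_mulmx p V : in_simplex p -> row_stochastic V -> in_simplex (p *m V).
Proof.
move=> [p0 p1] [V0 V1]; split.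
  by move=> l; rewrite mxE sumr_ge0 // => j _; rewrite mulr_ge0.
rewrite (eq_bigr (fun l => \sum_k p 0 k * V k l)) => [|l _]; last by rewrite mxE.
by rewrite exchange_big /= -p1; apply: eq_bigr => k _; rewrite -mulr_sumr V1 mulr1.
Qed.

(** As [p] is positive, a zero output probability would force a zero column of the invertible
    [V]. *)
Lemma output_gt0 p V l : (forall k, 0 < p 0 k) -> row_stochastic V -> V \in unitmx ->
  0 < (p *m V) 0 l.
Proof.
move=> p0 [V0 _] uV; have pV0 k : 0 <= p 0 k * V k l by rewrite mulr_ge0 // ltW.
rewrite mxE lt_neqAle sumr_ge0 // andbT eq_sym; apply/eqP => /eqP.
rewrite psumr_eq0 // => /allP pV.
have Vl : V *m delta_mx l (0 : 'I_1) = 0.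
  apply/matrixP => k j; rewrite -colE !mxE.
  by have := pV k (mem_index_enum k); rewrite /= mulf_eq0 gt_eqF //= => /eqP.
have /matrixP/(_ l 0) : delta_mx l 0 = 0 :> 'cV[R]_K by rewrite -(mulKmx uV (delta_mx l 0)) Vl mulmx0.
by rewrite !mxE !eqxx => /eqP; rewrite oner_eq0.
Qed.

Lemma unitmx_row_neq V i j : V \in unitmx -> i != j -> exists k, V i k != V j k.
Proof.
move=> uV ij; case: (boolP [forall k, V i k == V j k]) => [/forallP eqV|].
  have /row_free_inj Vinj : row_free V by rewrite row_free_unit.
  have : delta_mx 0 i = delta_mx 0 j :> 'rV[R]_K.
    by apply: Vinj; rewrite -!rowE; apply/rowP => k; rewrite !mxE; exact/eqP.
  by move/matrixP/(_ 0 i); rewrite !mxE !eqxx (negbTE ij) => /eqP; rewrite oner_eq0.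
by rewrite negb_forall => /existsP.
Qed.

(** Otherwise each row charges a single letter with mass 1. Invertibility makes the choice of letter
    injective, and [V] is a permutation matrix. *)
Lemma mixing_row V : row_stochastic V -> V \in unitmx -> ~~ is_perm_mx V ->
  exists l j1 j2, [/\ j1 != j2, 0 < V l j1 & 0 < V l j2].
Proof.
move=> [V0 V1] uV nperm.
case: (boolP [exists l, exists i, exists j, [&& i != j, 0 < V l i & 0 < V l j]]).
  by move=> /existsP[l /existsP[i /existsP[j /and3P[]]]]; exists l, i, j.
move=> /negP nmix; case/negP: nperm.
have row_pos l : exists j, 0 < V l j.
  case: (boolP [exists j, 0 < V l j]) => [/existsP //|]; rewrite negb_exists => /forallP Vl.
  have := V1 l; rewrite big1 => [/esym/eqP|j _]; first by rewrite oner_eq0.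
  by apply/eqP; rewrite eq_le V0 leNgt Vl.
have /fin_all_exists[s sP] := row_pos.
have Vs l j : V l j = (s l == j)%:R.
  have off i : s l != i -> V l i = 0.
    move=> si; apply/eqP; rewrite eq_le V0 andbT leNgt; apply/negP => Vi.
    apply: nmix; apply/existsP; exists l; apply/existsP; exists (s l).
    by apply/existsP; exists i; rewrite si sP.
  case: eqP => [<-|/eqP/off //]; rewrite -(V1 l) (bigD1 (s l)) //= big1 ?addr0 // => i.
  by rewrite eq_sym => /off.
have s_inj : injective s.
  move=> i j sij; apply/eqP/negPn/negP => /(unitmx_row_neq uV)[k].
  by rewrite !Vs sij eqxx.
apply/is_perm_mxP; exists (perm s_inj); apply/matrixP => i j.
by rewrite Vs !mxE permE.
Qed.

Lemma separable_loss_gap p V W (Proj : 'rV[R]_K -> 'rV[R]_K) (phi : 'I_K -> R -> R) :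
  in_simplex p -> (forall k, 0 < p 0 k) ->
  row_stochastic V -> V \in unitmx -> row_stochastic W -> W \in unitmx ->
  simplex_projection Proj -> ~~ is_perm_mx W ->
  (forall k, convex_nonneg (phi k)) -> (forall k, strictly_convex_at (phi k) (p 0 k)) ->
  exists N, forall n, (N <= n)%N ->
    expect p V (fun y : {ffun 'I_n -> 'I_K} => \sum_k phi k (estimator Proj V y 0 k)) <
    expect p (V *m W) (fun y : {ffun 'I_n -> 'I_K} =>
      \sum_k phi k (estimator Proj (V *m W) y 0 k)).
Proof.
move=> ps p0 Vs uV Ws uW projP nperm cvx strict.
have uVW : V *m W \in unitmx by rewrite unitmx_mul uV.
have uB : invmx (V *m W) \in unitmx by rewrite unitmx_inv.
have [l [i [j [ij Wi Wj]]]] := mixing_row Ws uW nperm.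
have [k Bk] := unitmx_row_neq uB ij.
(* Distinct rows of the inverse differ in some coordinate [k]; name the two letters so that the
   first has the smaller entry. *)
have [j1 [j2 [W1 W2 B12]]] : exists j1 j2, [/\ 0 < W l j1, 0 < W l j2 &
    invmx (V *m W) j1 k < invmx (V *m W) j2 k].
  by move: Bk; rewrite neq_lt => /orP[lt|lt]; [exists i, j | exists j, i].
have qA : p *m V *m invmx V = p by rewrite mulmxK.
have VB : W *m invmx (V *m W) = invmx V.
  by rewrite -[LHS](mulKmx uV) [V *m (W *m _)]mulmxA mulmxV ?mulmx1.
have [N gapN] := loss_gap_eventually_gt0 ps p0 projP (in_simplex_mulmx ps Vs)
  (fun l => output_gt0 l p0 Vs uV) Ws qA VB (invmx_row_sum uV Vs)
  (invmx_row_sum uVW (row_stochastic_mul Vs Ws)) cvx W1 W2 B12 (strict k).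
by exists N => n /gapN; rewrite !expectE mulmxA.
Qed.

(** Each summand of the divergence loss is the perspective of [f] at [p_k], which moves the point of
    strict convexity from 1 to [p_k]. *)
Lemma perspective_convex (f : R -> R) (P : R) : 0 < P -> convex_nonneg f ->
  convex_nonneg (fun t => P * f (t / P)).
Proof.
move=> P0 cvx x y lam x0 y0 lam01.
rewrite [leRHS](_ : _ = P * (lam * f (x / P) + (1 - lam) * f (y / P))); last by ring.
rewrite ler_pM2l // mulrDl -!mulrA.
by apply: cvx; rewrite ?divr_ge0 ?(ltW P0).
Qed.

Lemma perspective_strict (f : R -> R) (P : R) : 0 < P -> strictly_convex_at1 f ->
  strictly_convex_at (fun t => P * f (t / P)) P.
Proof.
move=> P0 sc a b lam a0 aP Pb lam01.
rewrite [ltRHS](_ : _ = P * (lam * f (a / P) + (1 - lam) * f (b / P))); last by ring.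
rewrite ltr_pM2l // mulrDl -!mulrA.
have -> : a / P = 1 - (1 - a / P) by ring.
have -> : b / P = 1 + (b / P - 1) by ring.
apply: sc => //; last by rewrite subr_gt0 ltr_pdivlMr // mul1r.
by rewrite subr_gt0 ltr_pdivrMr // mul1r aP gerBl divr_ge0 // ltW.
Qed.

Lemma square_convex (P : R) : convex_nonneg (fun t => (t - P) ^+ 2).
Proof.
move=> x y lam _ _ /andP[l0 l1].
have : 0 <= lam * (1 - lam) * (x - y) ^+ 2 by rewrite mulr_ge0 ?sqr_ge0 ?mulr_ge0 ?subr_ge0.
by lra.
Qed.

Lemma square_strict (P : R) : strictly_convex_at (fun t => (t - P) ^+ 2) P.
Proof.
move=> a b lam _ aP Pb /andP[l0 l1].
have : 0 < lam * (1 - lam) * (b - a) ^+ 2.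
  by rewrite !mulr_gt0 ?exprn_gt0 ?subr_gt0 // (lt_trans aP).
by lra.
Qed.

Lemma dist_convex (P : R) : convex_nonneg (fun t => `|t - P|).
Proof.
move=> x y lam _ _ /andP[l0 l1].
have -> : lam * x + (1 - lam) * y - P = lam * (x - P) + (1 - lam) * (y - P) by ring.
by apply: le_trans (ler_normD _ _) _; rewrite !normrM (ger0_norm l0) [`|1 - lam|]ger0_norm ?subr_ge0.
Qed.

(** [a - P] and [b - P] have opposite signs, so the triangle inequality is strict. *)
Lemma dist_strict (P : R) : strictly_convex_at (fun t => `|t - P|) P.
Proof.
move=> a b lam _ aP Pb /andP[l0 l1].
have -> : lam * a + (1 - lam) * b - P = lam * (a - P) + (1 - lam) * (b - P) by ring.
rewrite [`|a - P|]ltr0_norm ?[`|b - P|]gtr0_norm ?subr_lt0 ?subr_gt0 //.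
have : 0 < lam * (P - a) by rewrite mulr_gt0 ?subr_gt0.
have : 0 < (1 - lam) * (b - P) by rewrite mulr_gt0 ?subr_gt0.
by rewrite ltr_norml => h1 h2; apply/andP; split; lra.
Qed.

End Instances.

Theorem theorem5 (R : realType) (K : nat) (p : 'rV[R]_K) (W W' : 'M[R]_K)
  (Proj : 'rV[R]_K -> 'rV[R]_K) :
  (2 <= K)%N ->
  in_simplex p -> (forall k, 0 < p 0 k) ->
  row_stochastic W -> W \in unitmx ->
  row_stochastic W' -> W' \in unitmx ->
  simplex_projection Proj ->
  ~~ is_perm_mx W' ->
  (forall f : R -> R, convex_nonneg f -> f 1 = 0 -> strictly_convex_at1 f ->
     exists N : nat, forall n : nat, (N <= n)%N ->
       loss_fdiv f Proj p (W *m W') n > loss_fdiv f Proj p W n) /\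
  (exists N : nat, forall n : nat, (N <= n)%N ->
       loss_mse Proj p (W *m W') n > loss_mse Proj p W n) /\
  (exists N : nat, forall n : nat, (N <= n)%N ->
       loss_tv Proj p (W *m W') n > loss_tv Proj p W n).
Proof.
move=> _ ps p0 Ws uW Ws' uW' projP nperm.
have gap := separable_loss_gap ps p0 Ws uW Ws' uW' projP nperm.
split=> [f cvx _ strict|]; [|split].
- apply: (gap (fun k t => p 0 k * f (t / p 0 k))) => k.
    exact: perspective_convex.
  exact: perspective_strict.
- apply: (gap (fun k t => (t - p 0 k) ^+ 2)) => k; [exact: square_convex | exact: square_strict].
- apply: (gap (fun k t => `|t - p 0 k|)) => k; [exact: dist_convex | exact: dist_strict].
Qed.
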